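(* Let $d\geq 1$ be a fixed integer, let $p=p(n)=w(n)/n$ be a probability depending on the positive integer $n$ (so $0\leq p(n)\leq 1$), and let $F$ be an arbitrary nontrivial abelian group. Then: \begin{enumerate} \item if $\lim_{n\to\infty} w(n)=0$, then $\lim_{n\to\infty}\mathrm{Prob}(H_d(Y_{n,p,d};F)=0)=1$; \item if $\lim_{n\to\infty} w(n)=\infty$, then $\lim_{n\to\infty}\mathrm{Prob}(H_d(Y_{n,p,d};F)\neq 0)=1$. \end{enumerate}
   Context: For a positive integer $n$, $\Delta_n$ denotes the full $(n-1)$-dimensional simplex (on $n$ vertices). For a simplicial complex $\Delta$ and an integer $k\ge 0$, $\Delta^{(k)}$ denotes the $k$-dimensional skeleton of $\Delta$ and $\Delta(k)$ denotes the set of $k$-simplices of $\Delta$. For positive integers $n,d$ and a real number $0\leq p\leq 1$, $Y_{n,p,d}$ denotes the probability space whose underlying set consists of all simplicial complexes $\Delta$ on $n$ vertices (subcomplexes of $\Delta_n$) such that $\Delta^{(d-1)}=\Delta_n^{(d-1)}$ and $\Delta(d+1)=\emptyset$ (that is, $\Delta$ has dimension at most $d$ and contains the full $(d-1)$-skeleton), where the probability of $\Delta$ is $p^{|\Delta(d)|}(1-p)^{\binom{n}{d+1}-|\Delta(d)|}$; i.e. each $d$-simplex is included independently with probability $p$. $\mathrm{Prob}(H_d(Y_{n,p,d};F)=0)$ and $\mathrm{Prob}(H_d(Y_{n,p,d};F)\neq 0)$ denote the probabilities that, for $\Delta$ sampled from $Y_{n,p,d}$, the $d$-th simplicial homology group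 $H_d(\Delta;F)$ is trivial, respectively nontrivial. *)

(* Defs.v *)
From HB Require Import structures.
From mathcomp Require Import all_boot all_order all_algebra.
From mathcomp Require Import ring_quotient.
From mathcomp Require Import all_classical all_reals all_analysis.

Set Implicit Arguments.
Unset Strict Implicit.
Unset Printing Implicit Defensive.

From mathcomp Require Import zify.

Import Order.TTheory GRing.Theory Num.Theory.
Import numFieldNormedType.Exports.

Local Open Scope ring_scope.

(* The empty set is not a face.  Not every point of 'I_n has to be a vertex. *)
Definition is_complex n (D : {set {set 'I_n}}) : bool :=
  (finset.set0 \notin D) &&
  [forall s in D, forall t : {set 'I_n},
     (t != finset.set0) && (t \subset s) ==> (t \in D)].

Record simplicial_complex n := SimplicialComplex {
  faces :> {set {set 'I_n}};
  _ : is_complex faces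
}.

HB.instance Definition _ n := [isSub for @faces n].
HB.instance Definition _ n := [Finite of simplicial_complex n by <:].

Fact full_simplex_subproof n :
  is_complex [set s : {set 'I_n} | s != finset.set0].
Proof.
apply/andP; split; first by rewrite inE eqxx.
by apply/forall_inP => s _; apply/forallP => t; apply/implyP => /andP[t0 _]; rewrite inE.
Qed.

Definition full_simplex n : simplicial_complex n :=
  SimplicialComplex (full_simplex_subproof n).

Fact complex_closed n (D : simplicial_complex n) (s t : {set 'I_n}) :
  s \in (D : {set _}) -> t != finset.set0 -> t \subset s -> t \in (D : {set _}).
Proof.
case: D => D /= /andP[_ /forall_inP cl] /cl /forallP/(_ t)/implyP ct t0 ts.
by apply: ct; rewrite t0.
Qed.

Definition skeleton n k (D : simplicial_complex n) : {set {set 'I_n}} :=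
  [set s in (D : {set {set 'I_n}}) | #|s| <= k.+1]%N.

Definition simplices n k (D : simplicial_complex n) : {set {set 'I_n}} :=
  [set s in (D : {set {set 'I_n}}) | #|s| == k.+1]%N.

Section Homology.
Variables (n : nat) (D : simplicial_complex n).

Definition simplex k := {s : {set 'I_n} | s \in simplices k D}.

Definition chain k (F : zmodType) := {ffun simplex k -> F}.

(* The sign (-1) ^ i of the face of s opposite to its i-th vertex v, the
   vertices being numbered from 0 in increasing order. *)
Definition face_sign (s : {set 'I_n}) (v : 'I_n) : int :=
  (-1) ^+ #|[set u in s | (u < v)%N]|.

Variable F : zmodType.

(* For k = 0, as 0.-1 = 0, this is a map from chain 0 to chain 0.  It is zero
   because the inner sum is empty: both simplices have cardinality 1. *)
Definition boundary k (c : chain k F) : chain k.-1 F :=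
  [ffun t : simplex k.-1 => \sum_(s : simplex k)
     \sum_(v in val s | val t == val s :\ v) c s *~ face_sign (val s) v].

Fact boundary_is_zmod_morphism k : zmod_morphism (@boundary k).
Proof.
move=> a b; apply/ffunP => t; rewrite !ffunE -sumrB; apply: eq_bigr => s _.
by rewrite -sumrB; apply: eq_bigr => v _; rewrite !ffunE mulrzBl.
Qed.

HB.instance Definition _ k :=
  GRing.isZmodMorphism.Build (chain k F) (chain k.-1 F) (@boundary k)
    (@boundary_is_zmod_morphism k).

Variable k : nat.

Definition is_cycle : {pred chain k F} := [pred c | boundary c == 0].

Fact is_cycle_zmod_closed : zmod_closed is_cycle.
Proof.
split=> [|a b]; rewrite !inE ?raddf0 // => /eqP a0 /eqP b0.
by rewrite raddfB /= a0 b0 subrr.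
Qed.

HB.instance Definition _ :=
  GRing.isZmodClosed.Build (chain k F) is_cycle is_cycle_zmod_closed.

Record cycles := Cycle { cycle_chain :> chain k F; _ : cycle_chain \in is_cycle }.

HB.instance Definition _ := [isSub for cycle_chain].
HB.instance Definition _ := [Choice of cycles by <:].
HB.instance Definition _ := [SubChoice_isSubZmodule of cycles by <:].

(* Boundaries as a subgroup of the group of cycles, so that the homology group
   is a quotient of cycles; see boundary_boundary below. *)
Definition is_boundary : {pred cycles} :=
  [pred z | `[< exists c : chain k.+1 F, boundary c = val z >]].

Fact is_boundary_zmod_closed : zmod_closed is_boundary.
Proof.
split=> [|a b]; rewrite !inE; first by exists 0; rewrite !raddf0.
by move=> [c ca] [e eb]; exists (c - e); rewrite raddfB /= ca eb.
Qed.

HB.instance Definition _ :=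
  GRing.isZmodClosed.Build cycles is_boundary is_boundary_zmod_closed.

Definition homology : zmodType := Quotient.quot is_boundary.

End Homology.

Definition trivial_group (G : zmodType) : Prop := forall x : G, x = 0.

Fact boundary_boundary n (D : simplicial_complex n) (F : zmodType) k
  (c : chain D k.+2 F) : boundary (boundary c : chain D k.+1 F) = 0.
Proof.
apply/ffunP => r; rewrite [LHS]ffunE [RHS]ffunE.
pose e (s : simplex D k.+2) (q : 'I_n * 'I_n) : int :=
  face_sign (val s) q.1 * face_sign (val s :\ q.1) q.2.
pose P (s : simplex D k.+2) (q : 'I_n * 'I_n) :=
  [&& q.1 \in val s, q.2 \in val s, q.1 != q.2
    & val r == (val s :\ q.1) :\ q.2].
have sub_face (s : simplex D k.+2) u : u \in val s ->
    val s :\ u \in simplices k.+1 D.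
  move=> us; have := valP s; rewrite !inE => /andP[sD /eqP cs].
  have c1 : #|val s :\ u| = k.+2 by move: cs; rewrite (cardsD1 u) us add1n => -[].
  rewrite c1 eqxx andbT; apply: complex_closed sD _ (subD1set _ _).
  by rewrite -card_gt0 c1.
have -> : \sum_(t : simplex D k.+1) \sum_(v in val t | val r == val t :\ v)
     boundary c t *~ face_sign (val t) v
   = \sum_(s : simplex D k.+2) c s *~ (\sum_(q | P s q) e s q).
  transitivity (\sum_(s : simplex D k.+2) \sum_(u in val s)
     \sum_(v in val s :\ u | val r == val s :\ u :\ v) c s *~ e s (u, v)).
    transitivity (\sum_(t : simplex D k.+1) \sum_(s : simplex D k.+2)
        \sum_(u in val s | val t == val s :\ u)
        \sum_(v in val s :\ u | val r == val s :\ u :\ v) c s *~ e s (u, v)).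
      apply: eq_bigr => t _.
      transitivity (\sum_(s : simplex D k.+2) \sum_(u in val s | val t == val s :\ u)
        \sum_(v in val t | val r == val t :\ v) c s *~ e s (u, v)).
        under eq_bigr => v _.
          rewrite ffunE mulrz_suml.
          under eq_bigr => s _ do rewrite mulrz_suml.
          over.
        rewrite exchange_big /=; apply: eq_bigr => s _.
        rewrite exchange_big /=; apply: eq_bigr => u /andP[us /eqP tE].
        by apply: eq_bigr => v _; rewrite -mulrzA /e /= tE.
      apply: eq_bigr => s _; apply: eq_bigr => u /andP[us /eqP tE].
      by rewrite -tE.
    rewrite exchange_big /=; apply: eq_bigr => s _.
    rewrite (exchange_big_dep (fun u => u \in val s)) /=; last by move=> ? ? _ /andP[].
    apply: eq_bigr => u us.
    rewrite (big_pred1 (Sub (val s :\ u) (sub_face s u us))) // => t.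
    by rewrite us /= -val_eqE.
  apply: eq_bigr => s _; rewrite mulrz_sumr pair_big_dep /=.
  apply: eq_big => [[u v]|[u v] _] //=.
  by rewrite /P /= !inE [v == u]eq_sym; case: (u \in _); case: (v \in _); case: (u == v).
rewrite big1 // => s _.
suff -> : \sum_(q | P s q) e s q = 0 by rewrite mulr0z.
set S := \sum_(_ | _) _.
suff : S = - S by lia.
rewrite {1}/S -sumrN.
rewrite (reindex_inj (h := fun q : 'I_n * 'I_n => (q.2, q.1))) /=; last first.
  by move=> [a b] [a' b'] [-> ->].
apply: eq_big => [[u v]|[u v] /and4P[/= vs us vu _]].
  rewrite /P /= [v == u]eq_sym andbCA; do 3!congr (_ && _).
  by congr (_ == _); apply/setP => x; rewrite !inE andbCA.
have key (a b : 'I_n) : (a < b)%N -> a \in val s ->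
    face_sign (val s) b * face_sign (val s :\ b) a
    = - (face_sign (val s) a * face_sign (val s :\ a) b).
  move=> ab as_; rewrite /face_sign.
  have -> : [set x in val s :\ b | (x < a)%N] = [set x in val s | (x < a)%N].
    apply/setP => x; rewrite !inE; case: (eqVneq x b) => //= ->.
    by rewrite ltnNge (ltnW ab) andbF.
  have -> : [set x in val s :\ a | (x < b)%N] = [set x in val s | (x < b)%N] :\ a.
    by apply/setP => x; rewrite !inE andbA.
  rewrite (cardsD1 a [set x in val s | (x < b)%N]) inE as_ ab add1n.
  by rewrite exprS mulN1r mulNr mulrC.
rewrite /e /=; have [uv|uv|E] := ltngtP v u.
- by rewrite (key v u) // opprK.
- exact: key.
- by rewrite (val_inj E) eqxx in vu.
Qed.

(* The sample space of Y_{n,p,d}, for d > 0. *)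
Definition in_Y n d (D : simplicial_complex n) : bool :=
  (skeleton d.-1 D == skeleton d.-1 (full_simplex n)) &&
  (simplices d.+1 D == finset.set0).

(* 'C(n, d.+1) is the number of d-simplices of full_simplex n. *)
Definition Y_mass (R : realType) n (p : R) d (D : simplicial_complex n) : R :=
  p ^+ #|simplices d D| * (1 - p) ^+ ('C(n, d.+1) - #|simplices d D|).

Definition Y_prob (R : realType) n (p : R) d
    (E : simplicial_complex n -> Prop) : R :=
  \sum_(D : simplicial_complex n | in_Y d D && `[< E D >]) Y_mass p d D.

Fact Y_prob_setT (R : realType) n (p : R) d :
  (0 < d)%N -> Y_prob p d (fun _ : simplicial_complex n => True) = 1.
Proof.
move=> d0.
pose K := [set s : {set 'I_n} | #|s| == d.+1].
have cK : #|K| = 'C(n, d.+1) by rewrite card_draws card_ord.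
pose low := [set s : {set 'I_n} | 0 < #|s| <= d]%N.
have mk_complex (A : {set {set 'I_n}}) : is_complex (low :|: (A :&: K)).
  apply/andP; split; first by rewrite !inE cards0 andbF.
  apply/forall_inP => s sA; apply/forallP => t; apply/implyP => /andP[t0 ts].
  have [-> //|ts'] := eqVneq t s.
  have : (#|t| < #|s|)%N by apply: proper_card; rewrite finset.properEneq ts'.
  rewrite !inE card_gt0 t0 /=; move: sA.
  rewrite !inE => /orP[/andP[_ sd]|/andP[_ /eqP ->]].
    by move=> /ltnW/leq_trans/(_ sd) ->.
  by rewrite ltnS => ->.
pose h A := SimplicialComplex (mk_complex A).
have simplices_h A : simplices d (h A) = A :&: K.
  apply/setP => s; rewrite !inE /= ?inE.
  by case: (s \in A) => /=; lia.
have in_Y_h A : in_Y d (h A).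
  apply/andP; split; apply/eqP/setP => s; rewrite !inE /= ?inE -?card_gt0.
    by case: (s \in A) => /=; lia.
  by case: (s \in A) => /=; lia.
have hK D : in_Y d D && `[< True >] -> h (simplices d D) = D.
  rewrite asboolT // andbT => /andP[/eqP sk /eqP top]; apply: val_inj => /=.
  apply/setP => s.
  have D0 : finset.set0 \notin (D : {set _}) by case: (D) => ? /= /andP[].
  have Ds : (#|s| > d.+1)%N -> s \notin (D : {set _}).
    move=> ds; apply/negP => sD.
    have : (0 < #|[set t : {set 'I_n} | t \subset s & #|t| == d.+2]|)%N.
      by rewrite cards_draws bin_gt0.
    move=> /card_gt0P[t]; rewrite inE => /andP[ts td].
    move/setP/(_ t): (top); rewrite !inE td andbT => /negP; apply.
    by apply: complex_closed sD _ ts; rewrite -card_gt0 (eqP td).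
  have s0 : s \in (D : {set _}) -> (0 < #|s|)%N.
    by rewrite card_gt0; apply: contraTneq => ->.
  move/setP/(_ s): (sk); rewrite !inE -card_gt0.
  by case: (s \in _) Ds s0 => /= Ds s0; [have := s0 isT|]; lia.
rewrite /Y_prob (reindex_onto h (simplices d)) //=.
transitivity (\sum_(A : {set {set 'I_n}} | A \subset K)
    p ^+ #|A| * (1 - p) ^+ ('C(n, d.+1) - #|A|)).
  apply: eq_big => [A|A /andP[_ /eqP E]]; last by rewrite /Y_mass E.
  rewrite in_Y_h asboolT //= simplices_h; exact/eqP/finset.setIidPl.
rewrite -cK (partition_big (fun A : {set _} => inord #|A| : 'I_#|K|.+1) xpredT) //=.
transitivity ((1 - p + p) ^+ #|K|); last by rewrite subrK expr1n.
rewrite exprDn; apply: eq_bigr => i _.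
rewrite (eq_bigr (fun=> (1 - p) ^+ (#|K| - i) * p ^+ i)) => [|A /andP[AK /eqP <-]]; last first.
  by rewrite inordK ?ltnS ?subset_leq_card // mulrC.
rewrite sumr_const; congr (_ *+ _).
transitivity #|[set A : {set {set _}} | A \subset K & #|A| == i]|; last by rewrite cards_draws.
apply: eq_card => A.
rewrite !inE unfold_in /=; case: (boolP (A \subset K)) => //= AK.
by rewrite -val_eqE /= inordK // ltnS subset_leq_card.
Qed.

(* Main.v *)
Require Import Defs.
From mathcomp Require Import all_boot all_order all_algebra.
From mathcomp Require Import ring_quotient.
From mathcomp Require Import all_classical all_reals all_analysis.
From mathcomp Require Import zify ring lra.

Set Implicit Arguments.
Unset Strict Implicit.
Unset Printing Implicit Defensive.

Import Order.TTheory GRing.Theory Num.Theory.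
Import numFieldNormedType.Exports.

Local Open Scope ring_scope.

(** Let [p = w / n].

    Above the threshold, counting suffices.  The number of [d]-simplices is
    binomial with mean [p * 'C(n, d.+1)], which is of order [w * 'C(n, d)], so
    with high probability there are more [d]-simplices than the ['C(n, d)]
    possible [(d-1)]-simplices ([Y_prob_few_le]).  The integral boundary matrix
    then has more rows than columns, and its Smith normal form yields a cycle
    [u] with integer coefficients together with a Bezout relation
    [sum_i u_i w_i = 1] ([primitive_left_kernel]).  For any [f != 0] in [F], the
    chain [f * u] is a cycle, and the Bezout relation recovers [f] from its
    coefficients, so it is not zero ([homology_neq0]).

    Below the threshold, the support of a nonzero [d]-cycle has no free face:
    each facet of each of its simplices lies in a second one
    ([cycle_no_free_face]).  Inside such a support, grow a family [A] of
    simplices from a single one: while [A] has a free face [t], chosen as a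
    function of [A] alone, add a simplex [x |: t] of the support.  The family
    obtained when this stops is determined by the first simplex and the
    successive vertices [x].  There are about [n ^ (d + f)] choices that lead to
    a family of [f] simplices, and each family is present with probability
    [p ^ f = (w / n) ^ f], so a factor [n ^ d] has to be saved.  In a family
    without free faces every vertex lies in at least [d + 1] simplices, hence
    there are at most [f] vertices ([card_cover_le]).  Therefore at least [d] of
    the vertices [x] were old ones, for which there are at most [d + f] choices
    instead of [n].

    The union bound over explorations is carried out by induction on the number
    of remaining steps, with a weight [lam] on the steps that reuse an old
    vertex ([Y_prob_explores_le]).  With [lam = 1 + n / c], where [c] bounds the
    number of vertices seen, the weighted choices at each step still sum to at
    most [2 * n], while [d] old steps gain [lam ^- d <= (c / n) ^ d].  Summing
    over the length of the exploration gives a bound linear in [w]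
    ([Y_prob_nontrivial_le]). *)

(** * Families of simplices without free faces *)

Section FreeFaces.
Variables (V : finType) (k : nat).
Implicit Types (A S B : {set {set V}}) (s t : {set V}).

(** Free in the sense of simplicial collapses.  The facet is recorded by a simplex
    and the opposite vertex, since a step of the exploration needs both. *)
Definition free_face A (q : {set V} * V) : bool :=
  [&& q.1 \in A, q.2 \in q.1
    & [forall s in A, (q.1 :\ q.2 \subset s) ==> (s == q.1)]].

Definition no_free_face A : Prop := forall q, ~~ free_face A q.

Definition pure A : Prop := {in A, forall s, #|s| = k.+1}.

Lemma second_coface A s u : no_free_face A -> s \in A -> u \in s ->
  exists2 t, t \in A & (s :\ u \subset t) && (t != s).
Proof.
move=> /(_ (s, u)); rewrite /free_face /= => nf sA us.
move: nf; rewrite sA us /= => /forall_inPn[t tA].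
by rewrite negb_imply => ?; exists t.
Qed.

(** Crossing the facet of [s] opposite to [u] leads to a simplex that avoids [u]
    and contains the rest of [s].  So the [k] facets of [s] through [v] lead to
    [k] distinct simplices through [v], all different from [s]. *)
Lemma card_star A s v : pure A -> no_free_face A -> s \in A -> v \in s ->
  (k.+1 <= #|[set t in A | v \in t]|)%N.
Proof.
move=> cA nfA sA vs.
pose P u t := [&& t \in A, s :\ u \subset t & t != s].
have exP u : u \in s -> exists t, P u t.
  by move=> us; have [t tA /andP[]] := second_coface nfA sA us; exists t; apply/and3P.
(* The value of [f] at [v] is [s] itself, and at another [u] it is the simplex
   reached across the facet opposite to [u]. *)
pose f u := if u == v then s else odflt s [pick t | P u t].
have fv : f v = s by rewrite /f eqxx.
have fP u : u \in s -> u != v -> P u (f u).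
  move=> us /negPf uv; rewrite /f uv; case: pickP => //= none.
  by have [t] := exP u us; rewrite none.
have fA u : u \in s -> f u \in A.
  move=> us; have [->|uv] := eqVneq u v; first by rewrite fv.
  by have /and3P[] := fP u us uv.
have eq_s t : t \in A -> s \subset t -> t = s.
  move=> tA st; apply/esym/eqP; rewrite eqEcard st (cA t tA) (cA s sA); exact: leqnn.
have notin u : u \in s -> u != v -> u \notin f u.
  move=> us uv; have /and3P[uA sub ne] := fP u us uv.
  apply: contra ne => uf; apply/eqP/eq_s => //.
  by rewrite -(finset.setD1K us) finset.subUset finset.sub1set uf.
rewrite -(cA s sA) -(card_in_imset (f := f) (D := mem s)).
  apply/subset_leq_card/fintype.subsetP => _ /imsetP[u us ->].
  rewrite inE fA //=; have [->|uv] := eqVneq u v; first by rewrite fv.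
  have /and3P[_ /fintype.subsetP sub _] := fP u us uv.
  by apply: sub; rewrite !inE eq_sym uv.
have inj u u' : u \in s -> u' \in s -> u != v -> f u = f u' -> u = u'.
  move=> us u's uv E; apply/eqP/negPn/negP => uu'.
  have /negP := notin u us uv; apply; rewrite E.
  have [->|u'v] := eqVneq u' v; first by rewrite fv.
  have /and3P[_ /fintype.subsetP sub _] := fP u' u's u'v.
  by apply: sub; rewrite !inE uu'.
move=> u u' us u's E; have [uv|uv] := eqVneq u v; last exact: inj.
have [u'v|u'v] := eqVneq u' v; first by rewrite uv.
by apply/esym/inj.
Qed.

(** Double counting of the incidences between vertices and simplices: each of the
    [#|A|] simplices has [k.+1] vertices, and each vertex has degree at least
    [k.+1] by [card_star]. *)
Lemma card_cover_le A : pure A -> no_free_face A -> (#|finset.cover A| <= #|A|)%N.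
Proof.
move=> cA nfA; rewrite -(leq_pmul2r (ltn0Sn k)) -!sum_nat_const.
apply: (@leq_trans (\sum_(v in finset.cover A) #|[set t in A | v \in t]|)%N).
  apply: leq_sum => v /bigcupP[s sA vs]; exact: card_star vs.
apply: eq_leq.
under eq_bigr => v _ do rewrite -sum1_card.
rewrite (exchange_big_dep (fun s => s \in A)) /=; last first.
  by move=> v s _; rewrite inE => /andP[].
apply: eq_bigr => s sA; rewrite -(cA s sA) -sum1_card; apply: eq_bigl => v.
by rewrite inE sA /=; apply: andb_idl => vs; apply/bigcupP; exists s.
Qed.

Definition attach (q : {set V} * V) (x : V) : {set V} := x |: (q.1 :\ q.2).

(** The free face used at each step is picked as a function of [A], so the only
    freedom is the vertex [x].  Exactly [m] steps lead to a family without free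
    faces, and [A \subset B] is tested on this last family alone. *)
Fixpoint explores m A B : bool :=
  match [pick q | free_face A q], m with
  | None, 0 => A \subset B
  | Some q, m'.+1 =>
      [exists x, (x \notin q.1) && explores m' (attach q x |: A) B]
  | _, _ => false
  end.

(** A step adds one simplex and no vertex but [x], which may be an old one; these
    are the two increments that the weighted count in [Y_prob_explores_le]
    tracks. *)
Lemma attachP A q x : free_face A q -> pure A -> x \notin q.1 ->
  [/\ attach q x \notin A, pure (attach q x |: A)
    & finset.cover (attach q x |: A) = x |: finset.cover A].
Proof.
move=> /and3P[qA q2 /forall_inP qf] cA xq.
have xD : x \notin q.1 :\ q.2 by rewrite !inE (negPf xq) andbF.
split.
- apply/negP => /qf; rewrite finset.subsetUr /= => /eqP E.
  by move: xq; rewrite -E !inE eqxx.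
- move=> s; rewrite !inE => /orP[/eqP->|]; last exact: cA.
  by rewrite cardsU1 xD add1n -(cA _ qA) [in RHS](cardsD1 q.2) q2.
- rewrite /finset.cover finset.bigcup_setU big_set1 /attach -finset.setUA; congr (_ :|: _).
  apply/finset.setUidPr/(fintype.subset_trans (subD1set _ _)).
  exact: (finset.bigcup_sup q.1).
Qed.

(** The exploration can be steered inside [S]: a free face of [A] is not free in
    [S], so a second simplex of [S] through it can be attached. *)
Lemma explores_exists S B A : pure S -> no_free_face S -> A \subset S -> S \subset B ->
  exists2 m, (m <= #|S :\: A|)%N & explores m A B.
Proof.
move=> cS nfS + SB; have [m] := ubnP #|S :\: A|; elim: m A => // m IH A lem AS.
have cA : pure A by move=> s sA; apply/cS/(fintype.subsetP AS).
case E : [pick q | free_face A q] => [q|]; last first.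
  by exists 0%N => //=; rewrite E (fintype.subset_trans AS SB).
have qf : free_face A q by case: pickP E => // q' ? [<-].
have /and3P[qA q2 _] := qf.
have qS := fintype.subsetP AS _ qA.
have [t tS /andP[subt tq]] := second_coface nfS qS q2.
have /eqP : #|t :\: (q.1 :\ q.2)| = 1%N.
  rewrite cardsD (finset.setIidPr subt) cS //.
  by have := cS _ qS; rewrite (cardsD1 q.2) q2 add1n => -[->]; rewrite subSnn.
case/cards1P => x tx.
have tE : t = attach q x.
  rewrite /attach -tx finset.setDE finset.setUIl finset.setUC [~: _ :|: _]finset.setUC.
  by rewrite finset.setUCr finset.setIT; apply/esym/finset.setUidPr.
have xq : x \notin q.1.
  have : x \in t :\: (q.1 :\ q.2) by rewrite tx inE.
  rewrite !inE negb_and negbK => /andP[/orP[/eqP xq2|//] _].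
  by move: tq; rewrite tE /attach xq2 finset.setD1K ?eqxx.
have [tA cA' _] := attachP qf cA xq; rewrite -tE in tA cA'.
have lt : (#|S :\: (t |: A)| < #|S :\: A|)%N.
  have -> : S :\: (t |: A) = (S :\: A) :\ t.
    by apply/setP => s; rewrite !inE negb_or andbA.
  by rewrite [X in (_ < X)%N](cardsD1 t) !inE tA tS add1n.
have [||m' lem' ex] := IH (t |: A).
- by rewrite (leq_trans lt).
- by rewrite finset.subUset finset.sub1set tS.
exists m'.+1; first exact: leq_ltn_trans lt.
by rewrite /= E; apply/existsP; exists x; rewrite xq -tE.
Qed.

End FreeFaces.

(** * Homology in the top dimension *)

Section TopHomology.
Variables (n : nat) (D : simplicial_complex n) (F : zmodType) (k : nat).

(** Without simplices of dimension [k + 1], homology in degree [k] is the group of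
    cycles. *)
Lemma homology_top : simplices k.+1 D = finset.set0 ->
  trivial_group (homology D F k) <-> forall c : chain D k F, boundary c = 0 -> c = 0.
Proof.
move=> top.
have bd0 (c : chain D k.+1 F) : boundary c = 0.
  apply/ffunP => t; rewrite !ffunE big1 // => s.
  by case: s => s sD; exfalso; rewrite top inE in sD.
split=> [triv c /eqP c0|inj x].
  pose z : cycles D F k := Cycle (c0 : c \in @is_cycle n D F k).
  have : z - 0 \in @is_boundary n D F k.
    by rewrite Quotient.idealrBE; apply/eqP; rewrite [LHS]triv [RHS]triv.
  by rewrite subr0 inE => -[e E]; rewrite -[c]/(val z) -E; exact: bd0.
have repr0 (y : homology D F k) : repr y = 0.
  apply: val_inj; apply: inj; apply/eqP; exact: (valP (repr y)).
by rewrite -[x]reprK -[0 in RHS]reprK !repr0.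
Qed.

Definition incidence (s : simplex D k) (t : simplex D k.-1) : int :=
  \sum_(v in val s | val t == val s :\ v) face_sign (val s) v.

Lemma boundaryE (c : chain D k F) t :
  boundary c t = \sum_s c s *~ incidence s t.
Proof.
by rewrite ffunE; apply: eq_bigr => s _; rewrite mulrz_sumr.
Qed.

End TopHomology.

(** In the Smith normal form [L *m E *m Q] of [M] the last row of [E] is zero, as
    [E] is diagonal with more rows than columns.  So the last row of [invmx L]
    kills [M], and its product with the last column of [L] is [1].  The vector
    [w] certifies that [u] stays nonzero after tensoring with any group. *)
Lemma primitive_left_kernel m n (M : 'M[int]_(m, n)) : (n < m)%N ->
  exists (u : 'rV[int]_m) (w : 'cV[int]_m), u *m M = 0 /\ u *m w = 1%:M.
Proof.
move=> nm; have [L Lu [Q Qu [e _ ->]]] := int_Smith_normal_form M.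
case: m nm M L Lu => // m nm M L Lu.
exists (row ord_max (invmx L)), (col ord_max L); split.
  rewrite !mulmxA -row_mul mulVmx // -row_mul mul1mx.
  suff -> : row ord_max (\matrix_(i < m.+1, j < n) (e`_i *+ (i == j :> nat))) = 0 :> 'rV_n.
    by rewrite mul0mx.
  apply/rowP => j; rewrite !mxE /= [_ == _](_ : _ = false) //.
  by apply/eqP => E; have := ltn_ord j; rewrite -E ltnNge -ltnS nm.
apply/matrixP => i j; rewrite !ord1 [RHS]mxE eqxx.
have /matrixP/(_ ord_max ord_max) := mulVmx Lu; rewrite [RHS]mxE eqxx => <-.
by rewrite !mxE; apply: eq_bigr => l _; rewrite !mxE.
Qed.

Lemma homology_neq0 n (D : simplicial_complex n) (F : zmodType) k :
  ~ trivial_group F -> simplices k.+1 D = finset.set0 ->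
  (#|simplices k.-1 D| < #|simplices k D|)%N ->
  ~ trivial_group (homology D F k).
Proof.
move=> F0 top lt /homology_top-/(_ top) inj; apply: F0 => f.
have cardE j : #|{: simplex D j}| = #|simplices j D|.
  by rewrite card_sig; apply: eq_card => s.
pose M : 'M[int]_(#|{: simplex D k}|, #|{: simplex D k.-1}|) :=
  \matrix_(i, j) incidence (enum_val i) (enum_val j).
have [|u [w [uM uw]]] := primitive_left_kernel M; first by rewrite !cardE.
pose c : chain D k F := [ffun s => f *~ u 0 (enum_rank s)].
have c0 : c = 0.
  apply: inj; apply/ffunP => t; rewrite boundaryE ffunE.
  under eq_bigr => s _ do rewrite ffunE -mulrzA.
  rewrite -mulrz_sumr (reindex (@enum_val _ xpredT)) /=; last exact/onW_bij/enum_val_bij.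
  have /matrixP/(_ 0 (enum_rank t)) := uM; rewrite !mxE => E.
  rewrite (_ : \sum_(j | _) _ = 0) // -[RHS]E; apply: eq_bigr => i _.
  by rewrite mxE enum_valK enum_rankK.
have E : \sum_i u 0 i * w i 0 = 1.
  by have /matrixP/(_ 0 0) := uw; rewrite !mxE.
rewrite -[f]mulr1z -E mulrz_sumr big1 // => i _.
have /ffunP/(_ (enum_val i)) := c0; rewrite !ffunE enum_valK mulrzA => ->.
by rewrite mul0rz.
Qed.

Definition support n (D : simplicial_complex n) (F : zmodType) k (c : chain D k F) :
  {set {set 'I_n}} := [set val s | s : simplex D k & c s != 0].

(** At a facet that lies in a single simplex [s] of the support, the boundary has
    the single term [c s] up to sign, which is not zero. *)
Lemma cycle_no_free_face n (D : simplicial_complex n) (F : zmodType) k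
    (c : chain D k F) : (0 < k)%N -> boundary c = 0 -> no_free_face (support c).
Proof.
move=> k0 bc [q u]; apply/negP => /and3P[/= /imsetP[s]].
rewrite inE => cs -> us /forall_inP fr.
have st : val s :\ u \in simplices k.-1 D.
  have := valP s; rewrite !inE prednK // => /andP[sD].
  rewrite [#|val s|](cardsD1 u) us add1n eqSS => /eqP cu; rewrite cu eqxx andbT.
  apply: complex_closed sD _ (subD1set _ _).
  by rewrite -card_gt0 cu.
have /ffunP/(_ (Sub (val s :\ u) st)) := bc; rewrite boundaryE ffunE.
rewrite (bigD1 s) //= big1 ?addr0; last first.
  move=> s' s's; have [->|cs'] := eqVneq (c s') 0; first by rewrite mul0rz.
  rewrite /incidence big_pred0 ?mulr0z // => v /=; apply/negP => /andP[vs' /eqP E].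
  have /fr : val s' \in support c by apply/imsetP; exists s' => //; rewrite inE.
  by rewrite E subD1set /= val_eqE (negPf s's).
rewrite /incidence (big_pred1 u) => [E|v] /=; last first.
  apply/andP/eqP => [[vs /eqP E]|->]; last by [].
  apply/eqP/negPn/negP => vu.
  by have := setD11 v (val s); rewrite -E !inE vu vs.
move: E; rewrite /face_sign -signr_odd; case: odd; rewrite ?expr0 ?expr1 ?mulrNz mulr1z.
  by move/eqP; rewrite oppr_eq0 (negPf cs).
by move/eqP; rewrite (negPf cs).
Qed.

(** * Events of the random complex *)

Section RandomComplex.
Variables (R : realType) (n d : nat).
Implicit Types (D : simplicial_complex n) (A : {set {set 'I_n}}).

Lemma in_Y_top D : in_Y d D -> simplices d.+1 D = finset.set0.
Proof. by case/andP => _ /eqP. Qed.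

(** All the freedom in a sample is its set of [d]-simplices, so that sums over the
    sample space are bounded by sums over sets of potential [d]-simplices. *)
Lemma in_Y_inj : (0 < d)%N -> {in in_Y d &, injective (@simplices n d)}.
Proof.
move=> d0 D D' YD YD' E; apply: val_inj => /=; apply/setP => s.
have large D1 : in_Y d D1 -> (d.+1 < #|s|)%N -> s \notin (D1 : {set _}).
  move=> /in_Y_top top ds; apply/negP => sD.
  have /card_gt0P[t] : (0 < #|[set t : {set 'I_n} | t \subset s & #|t| == d.+2]|)%N.
    by rewrite cards_draws bin_gt0.
  rewrite inE => /andP[ts td].
  have tD : t \in (D1 : {set _}).
    by apply: complex_closed sD _ ts; rewrite -card_gt0 (eqP td).
  have : t \in simplices d.+1 D1 by rewrite inE tD.
  by rewrite top inE.
have small D1 : in_Y d D1 -> (#|s| <= d)%N -> (s \in (D1 : {set _})) = (0 < #|s|)%N.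
  case/andP=> /eqP/setP/(_ s); rewrite !inE prednK // card_gt0 => + _ sd.
  by rewrite sd !andbT.
have [sd|ds] := leqP #|s| d; first by rewrite !small.
have [ds'|sd] := ltnP d.+1 #|s|; first by rewrite !(negPf (large _ _ ds')).
have cs : #|s| = d.+1 by apply/eqP; rewrite eqn_leq sd.
by move/setP/(_ s) : E; rewrite !inE cs eqxx !andbT.
Qed.

Definition potential_simplices : {set {set 'I_n}} :=
  [set s : {set 'I_n} | #|s| == d.+1].

Lemma card_potential_simplices : #|potential_simplices| = 'C(n, d.+1).
Proof. by rewrite card_draws card_ord. Qed.

Lemma simplices_potential D : simplices d D \subset potential_simplices.
Proof. by apply/fintype.subsetP => s; rewrite !inE => /andP[]. Qed.

(** The inequality form of independence.  The right-hand side expands into a sum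
    of nonnegative terms over all subsets of the potential simplices, and the
    terms on the left are distinct terms of this expansion. *)
Lemma sum_prod_in_Y_le (f g : {set 'I_n} -> R) : (0 < d)%N ->
  (forall s, 0 <= f s) -> (forall s, 0 <= g s) ->
  \sum_(D | in_Y d D) (\prod_(s in simplices d D) f s *
     \prod_(s in potential_simplices :\: simplices d D) g s)
  <= \prod_(s in potential_simplices) (f s + g s).
Proof.
move=> d0 f0 g0; set K := potential_simplices.
pose f' s := if s \in K then f s else 0.
pose g' s := if s \in K then g s else 1.
rewrite [leRHS](_ : _ = \prod_s (f' s + g' s)); last first.
  rewrite big_mkcond; apply: eq_bigr => s _; rewrite /f' /g'.
  by case: ifP; rewrite ?add0r.
rewrite bigA_distr; pose h (J : {set {set 'I_n}}) := \prod_s (if s \in J then f' s else g' s).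
have h0 J : 0 <= h J.
  by apply: prodr_ge0 => s _; rewrite /f' /g'; do 2!case: ifP.
rewrite (eq_bigr (fun D => h (simplices d D))) => [|D _]; last first.
  rewrite /h [RHS](bigID (mem (simplices d D))) /=; congr (_ * _).
    apply: eq_bigr => s sD.
    by rewrite sD /f' (fintype.subsetP (simplices_potential D)).
  rewrite big_mkcond [RHS]big_mkcond; apply: eq_bigr => s _ /=.
  by rewrite finset.in_setD /g'; case: (s \in simplices d D).
rewrite (eq_bigl (mem [set D | in_Y d D])) => [|D]; last by rewrite /= inE.
rewrite -(big_imset h) /=; last by move=> D D'; rewrite !inE; exact: in_Y_inj.
rewrite big_mkcond [leRHS]big_mkcond; apply: ler_sum => J _.
by case: ifP => // _; exact: h0.
Qed.

Variable p : R.
Hypothesis p01 : 0 <= p <= 1.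

Let p0 : 0 <= p. Proof. by case/andP: p01. Qed.
Let q0 : 0 <= 1 - p. Proof. by rewrite subr_ge0; case/andP: p01. Qed.

Lemma Y_mass_ge0 D : 0 <= Y_mass p d D.
Proof. by rewrite mulr_ge0 ?exprn_ge0. Qed.

Lemma Y_massE D : Y_mass p d D = \prod_(s in simplices d D) p *
  \prod_(s in potential_simplices :\: simplices d D) (1 - p).
Proof.
rewrite !prodr_const cardsD (finset.setIidPr (simplices_potential D)).
by rewrite card_potential_simplices.
Qed.

Lemma Y_prob_le1 (E : simplicial_complex n -> Prop) : (0 < d)%N -> Y_prob p d E <= 1.
Proof.
move=> d0; rewrite -(Y_prob_setT n p d0) /Y_prob big_mkcond [leRHS]big_mkcond /=.
apply: ler_sum => D _; rewrite [`[< True >]]asboolT // andbT.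
by case: in_Y; case: asboolP => //= _; exact: Y_mass_ge0.
Qed.

Lemma Y_prob_not (E : simplicial_complex n -> Prop) : (0 < d)%N ->
  Y_prob p d E = 1 - Y_prob p d (fun D => ~ E D).
Proof.
move=> d0; apply/eqP; rewrite -subr_eq opprK -(Y_prob_setT n p d0).
rewrite eq_sym /Y_prob (bigID (fun D => `[< E D >])) /=; apply/eqP.
congr (_ + _); apply: eq_bigl => D; rewrite [`[< True >]]asboolT // andbT //.
by rewrite asbool_neg.
Qed.

Lemma Y_prob_union (I : finType) (P : pred I) (E : simplicial_complex n -> Prop)
    (G : I -> simplicial_complex n -> Prop) :
  (forall D, in_Y d D -> E D -> exists2 i, P i & G i D) ->
  Y_prob p d E <= \sum_(i | P i) Y_prob p d (G i).
Proof.
move=> EG; rewrite /Y_prob.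
under [leRHS]eq_bigr => i _ do rewrite big_mkcondr.
rewrite exchange_big /= big_mkcondr; apply: ler_sum => D YD.
have ge0 i : 0 <= if `[< G i D >] then Y_mass p d D else 0.
  by case: ifP => // _; exact: Y_mass_ge0.
case: asboolP => [/(EG _ YD)[i Pi Gi]|_]; last exact: sumr_ge0.
by rewrite (bigD1 i) //= asboolT // lerDl sumr_ge0.
Qed.

Lemma Y_prob_contains_le A : (0 < d)%N -> A \subset potential_simplices ->
  Y_prob p d (fun D => A \subset simplices d D) <= p ^+ #|A|.
Proof.
move=> d0 AK; pose g s := if s \in A then 0 else 1 - p.
have -> : p ^+ #|A| = \prod_(s in potential_simplices) (p + g s).
  rewrite (finset.big_setID A) /= (finset.setIidPr AK) [X in _ * X]big1 ?mulr1.
    by rewrite -prodr_const; apply: eq_bigr => s sA; rewrite /g sA addr0.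
  by move=> s; rewrite inE /g => /andP[/negPf-> _]; rewrite addrC subrK.
have g0 s : 0 <= g s by rewrite /g; case: ifP.
apply: le_trans (sum_prod_in_Y_le d0 _ g0) => //.
rewrite /Y_prob big_mkcondr; apply: ler_sum => D YD.
case: asboolP => [AD|_]; last by rewrite mulr_ge0 ?prodr_ge0.
rewrite Y_massE le_eqVlt; apply/orP; left; apply/eqP; congr (_ * _).
apply: eq_bigr => s; rewrite inE /g => /andP[sD _].
by case: ifP => // /(fintype.subsetP AD); rewrite (negPf sD).
Qed.

(** Markov's inequality for [2 ^- X], where [X] is the number of [d]-simplices:
    the expectation of [2 ^- X] is that of a product of independent factors. *)
Lemma Y_prob_few_le M : (0 < d)%N ->
  Y_prob p d (fun D => (#|simplices d D| <= M)%N)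
    <= 2 ^+ M * (1 - p / 2) ^+ 'C(n, d.+1).
Proof.
move=> d0; have p20 : 0 <= p / 2 by rewrite divr_ge0.
have -> : (1 - p / 2) ^+ 'C(n, d.+1) =
    \prod_(s in potential_simplices) (p / 2 + (1 - p)).
  by rewrite prodr_const card_potential_simplices; congr (_ ^+ _); field.
apply: le_trans (ler_wpM2l _ (sum_prod_in_Y_le d0 _ _)) => //.
rewrite mulr_sumr /Y_prob big_mkcondr; apply: ler_sum => D YD.
have ge0 : 0 <= \prod_(s in potential_simplices :\: simplices d D) (1 - p).
  by apply: prodr_ge0.
case: asboolP => [DM|_]; last by rewrite !mulr_ge0 ?prodr_ge0.
rewrite Y_massE mulrA ler_wpM2r // !prodr_const exprMn mulrCA ler_peMr ?exprn_ge0 //.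
by rewrite exprVn -(subnK DM) exprD mulfK ?expf_neq0 // exprn_ege1 // ler1n.
Qed.

End RandomComplex.

(** * Sparse regime: the exploration count *)

(** At a family [A] the exploration has made [#|A| - 1] steps and met
    [#|finset.cover A| - (d + 1)] new vertices, so the last factor of the bound is
    [lam] to the number of old steps minus [d].  At the end this exponent is
    nonnegative by [card_cover_le].  One step multiplies the sum of the weights
    by at most [n + (lam - 1) * c <= 2 * n]. *)
Lemma Y_prob_explores_le (R : realType) (n d : nat) (p lam c : R) m
    (A : {set {set 'I_n}}) :
  (0 < d)%N -> 0 <= p <= 1 -> 1 <= lam -> (lam - 1) * c <= n%:R ->
  pure d A -> (#|finset.cover A| + m)%:R <= c ->
  Y_prob p d (fun D => explores m A (simplices d D))
    <= p ^+ (#|A| + m) * (2 * n%:R) ^+ m * (lam ^+ #|A| / lam ^+ #|finset.cover A|).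
Proof.
move=> d0 p01 lam1 lamc; have p0 : 0 <= p by case/andP: p01.
have lam0 : 0 < lam by apply: lt_le_trans lam1.
have ge0 k (A' : {set {set 'I_n}}) : 0 <= p ^+ (#|A'| + k) * (2 * n%:R) ^+ k *
     (lam ^+ #|A'| / lam ^+ #|finset.cover A'|) :> R.
  by rewrite !mulr_ge0 ?invr_ge0 ?exprn_ge0 ?mulr_ge0 // ltW.
elim: m A => [|m IH] A pA cA; case E : [pick q | free_face A q] => [q|].
- rewrite /= E [leLHS](_ : _ = 0) ?ge0 //.
  by rewrite /Y_prob big_pred0 // => D; rewrite asboolF ?andbF.
- rewrite /= E addn0 expr0 mulr1.
  have nf : no_free_face A by move=> q; case: pickP E => // /(_ q)->.
  have AK : A \subset potential_simplices n d.
    by apply/fintype.subsetP => s /pA cs; rewrite inE cs.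
  apply: le_trans (Y_prob_contains_le p01 d0 AK) _.
  rewrite ler_peMr ?exprn_ge0 // ler_pdivlMr ?exprn_gt0 // mul1r.
  by rewrite ler_weXn2l // (card_cover_le pA).
- have qf : free_face A q by case: pickP E => // q' ? [<-].
  rewrite /= E; set U := finset.cover A.
  set C := p ^+ (#|A| + m.+1) * (2 * n%:R) ^+ m * (lam ^+ #|A| / lam ^+ #|U|).
  have C0 : 0 <= C by rewrite !mulr_ge0 ?invr_ge0 ?exprn_ge0 ?mulr_ge0 // ltW.
  apply: le_trans (Y_prob_union (P := fun x => x \notin q.1)
    (G := fun x D => explores m (attach q x |: A) (simplices d D)) p01 _) _.
    by move=> D _ /existsP[x /andP[xq ex]]; exists x.
  apply: (@le_trans _ _ (\sum_(x : 'I_n) C * (if x \in U then lam else 1))).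
    rewrite big_mkcond; apply: ler_sum => x _.
    case: ifP => xq; last by rewrite mulr_ge0 //; case: ifP => // _; exact: ltW.
    have [tA pA' cov] := attachP qf pA xq.
    have cU : #|finset.cover (attach q x |: A)| = ((x \notin U) + #|U|)%N.
      by rewrite cov cardsU1.
    have := IH _ pA'; rewrite cU cardsU1 tA add1n addSnnS => /(_ _)/le_trans; apply.
      apply: le_trans cA.
      by rewrite ler_nat -/U -addnA -add1n [leqRHS]addnCA leq_add2r leq_b1.
    rewrite /C -!mulrA ler_wpM2l ?exprn_ge0 // ler_wpM2l ?exprn_ge0 ?mulr_ge0 //.
    rewrite exprS; case: (x \in U) => /=.
      by rewrite add0n [lam * _]mulrC -mulrA [lam / _]mulrC.
    by rewrite add1n exprS mulr1 -mulf_div divff ?mul1r // gt_eqF.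
  have -> : p ^+ (#|A| + m.+1) * (2 * n%:R) ^+ m.+1 * (lam ^+ #|A| / lam ^+ #|U|)
      = C * (2 * n%:R) by rewrite /C exprSr [p ^+ _ * (_ * _)]mulrA mulrAC.
  rewrite -mulr_sumr; apply: (ler_wpM2l C0).
  rewrite (eq_bigr (fun x => 1 + (if x \in U then lam - 1 else 0))); last first.
    by move=> x _; case: ifP; rewrite ?addr0 // addrC subrK.
  rewrite big_split /= sumr_const card_ord -big_mkcond sumr_const.
  rewrite -[(lam - 1) *+ _]mulr_natr [2 * _]mulr_natl mulr2n lerD2l.
  rewrite (le_trans _ lamc) // ler_wpM2l ?subr_ge0 //.
  by apply: le_trans cA; rewrite ler_nat leq_addr.
- rewrite /= E [leLHS](_ : _ = 0) ?ge0 //.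
  by rewrite /Y_prob big_pred0 // => D; rewrite asboolF ?andbF.
Qed.

Lemma exp_le_ffact a d : (a ^ d <= (a + d) ^_ d)%N.
Proof.
rewrite ffact_prod -[X in (_ ^ X)%N]card_ord -prod_nat_const.
by apply: leq_prod => i _; have := ltn_ord i; lia.
Qed.

Lemma bin_le_exp2 a b : ('C(a, b) <= 2 ^ a)%N.
Proof.
elim: a b => [|a IH] [|b]; rewrite ?bin0 ?bin0n ?expn_gt0 //.
by rewrite binS expnS mul2n -addnn leq_add.
Qed.

(** Polynomial growth in [a] is absorbed by a geometric factor, with an explicit
    constant. *)
Lemma exp_le_exp2 a d : (a ^ d <= d`! * 2 ^ (a + d))%N.
Proof.
by rewrite (leq_trans (exp_le_ffact a d)) // -bin_ffact mulnC leq_mul2l bin_le_exp2 orbT.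
Qed.

Lemma sum_half_le2 (R : realFieldType) N : \sum_(m < N) (2^-1 : R) ^+ m <= 2.
Proof.
suff -> : \sum_(m < N) (2^-1 : R) ^+ m = 2 - 2 * 2^-1 ^+ N.
  by rewrite gerBl mulr_ge0 // exprn_ge0.
elim: N => [|N IH]; first by rewrite big_ord0 expr0; ring.
by rewrite big_ord_recr IH exprS /=; field.
Qed.

Lemma Y_prob_nontrivial_le (R : realType) (n d : nat) (p : R) (F : zmodType) :
  (0 < d)%N -> (0 < n)%N -> 0 <= p <= 1 -> p * n%:R <= 8^-1 ->
  Y_prob p d (fun D : simplicial_complex n => ~ trivial_group (homology D F d))
    <= 4 * (d`! * 4 ^ d)%:R * (p * n%:R).
Proof.
move=> d0 n0 p01 w8; have p0 : 0 <= p by case/andP: p01.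
have nR0 : 0 < n%:R :> R by rewrite ltr0n.
set K := potential_simplices n d; set N := #|K|.+1.
(* Union bound over the first simplex and the number of steps of an exploration
   of the support of a nonzero cycle. *)
apply: le_trans (Y_prob_union (P := fun i : {set 'I_n} * 'I_N => i.1 \in K)
    (G := fun i D => explores i.2 [set i.1] (simplices d D)) p01 _) _.
  move=> D YD /(homology_top _ (in_Y_top YD)) /existsNP[c] /not_implyP[bc /eqP cn0].
  have [s cs] : exists s, c s != 0.
    apply/existsP; apply: contraNT cn0 => /existsPn c0; apply/eqP/ffunP => s.
    by rewrite ffunE; apply/eqP; rewrite -[_ == _]negbK c0.
  have pS : pure d (support c).
    by move=> _ /imsetP[t _ ->]; have := valP t; rewrite !inE => /andP[_ /eqP].
  have SD : support c \subset simplices d D.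
    by apply/fintype.subsetP => _ /imsetP[t _ ->]; exact: valP.
  have sS : [set val s] \subset support c.
    by rewrite finset.sub1set; apply/imsetP; exists s; rewrite ?inE.
  have [m lem ex] := explores_exists pS (cycle_no_free_face d0 bc) sS SD.
  have SK : support c \subset K := fintype.subset_trans SD (simplices_potential d D).
  have mN : (m < N)%N.
    rewrite ltnS (leq_trans lem) // (leq_trans (subset_leq_card _) (subset_leq_card SK)) //.
    exact: finset.subsetDl.
  exists (val s, Ordinal mN); last exact: ex.
  by apply: (fintype.subsetP (simplices_potential d D)); exact: valP.
rewrite [leLHS](_ : _ = \sum_(s in K) \sum_(m < N)
    Y_prob p d (fun D => explores m [set s] (simplices d D))); last first.
  by rewrite pair_big; apply: eq_bigl => i; rewrite andbT.
have w0 : 0 <= p * n%:R by rewrite mulr_ge0.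
pose B : R := 2 * (d`! * 4 ^ d)%:R / n%:R ^+ d.+1 * (p * n%:R).
have B0 : 0 <= B by rewrite mulr_ge0 // divr_ge0 // exprn_ge0.
apply: (@le_trans _ _ (\sum_(s in K) \sum_(m < N) B * 2^-1 ^+ m)).
  apply: ler_sum => s sK; apply: ler_sum => m _.
  have cs : #|s| = d.+1 by move: sK; rewrite inE => /eqP.
  have cov : finset.cover [set s] = s by rewrite /finset.cover big_set1.
  (* After [m] steps at most [d.+1 + m] vertices have been met. *)
  set c : R := (d.+1 + m)%:R; have c0 : 0 < c by rewrite ltr0n.
  pose lam : R := 1 + n%:R / c.
  have nc0 : 0 < n%:R / c by rewrite divr_gt0.
  apply: le_trans (@Y_prob_explores_le _ _ _ p lam c _ _ d0 p01 _ _ _ _) _.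
  - by rewrite /lam lerDl ltW.
  - by rewrite /lam addrC addKr divfK // gt_eqF.
  - by move=> t; rewrite inE => /eqP ->.
  - by rewrite cov cs.
  have lam0 : lam != 0 by rewrite gt_eqF // addr_gt0.
  have -> : lam ^+ #|[set s]| / lam ^+ #|finset.cover [set s]| = (lam ^+ d)^-1.
    by rewrite cov cs cards1 expr1 exprS invfM mulrA divff ?mul1r.
  rewrite cards1 add1n.
  have lamd : (lam ^+ d)^-1 <= c ^+ d / n%:R ^+ d.
    rewrite -expr_div_n -[c / _]invf_div exprVn lef_pV2 ?posrE ?exprn_gt0 //.
      by rewrite lerXn2r ?nnegrE ?lerDr // ltW // addr_gt0.
    by rewrite addr_gt0.
  have cd : c ^+ d <= 2 * (d`! * 4 ^ d)%:R * 2 ^+ m.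
    have -> : 2 * (d`! * 4 ^ d)%:R * 2 ^+ m = (2 * (d`! * 4 ^ d) * 2 ^ m)%:R :> R.
      by rewrite !natrM !natrX.
    rewrite /c -natrX ler_nat.
    rewrite (leq_trans (exp_le_exp2 _ _)) // mulnCA -mulnA leq_mul2l.
    have -> : (4 ^ d = 2 ^ (d + d))%N by rewrite -[4%N]/(2 ^ 2)%N -expnM mul2n addnn.
    by rewrite -expnS -expnD addnAC addSn leqnn orbT.
  apply: (@le_trans _ _ (p ^+ m.+1 * (2 * n%:R) ^+ m *
     (2 * (d`! * 4 ^ d)%:R * 2 ^+ m / n%:R ^+ d))).
    rewrite ler_wpM2l ?mulr_ge0 ?exprn_ge0 ?mulr_ge0 // ?add1n //.
    by rewrite (le_trans lamd) // ler_wpM2r // invr_ge0 exprn_ge0.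
  have -> : p ^+ m.+1 * (2 * n%:R) ^+ m * (2 * (d`! * 4 ^ d)%:R * 2 ^+ m / n%:R ^+ d)
     = B * (4 * (p * n%:R)) ^+ m.
    rewrite /B !exprS !exprMn.
    have -> : 4 ^+ m = 2 ^+ m * 2 ^+ m :> R by rewrite -exprMn -natrM.
    by field; rewrite !expf_neq0 ?gt_eqF.
  by rewrite ler_wpM2l // lerXn2r ?nnegrE ?mulr_ge0 ?invr_ge0 //; lra.
under eq_bigr => s _ do rewrite -mulr_sumr.
rewrite sumr_const -[leLHS]mulr_natr card_potential_simplices.
have binn : 'C(n, d.+1)%:R <= n%:R ^+ d.+1 :> R.
  rewrite -natrX ler_nat (leq_trans (leq_pmulr _ (fact_gt0 d.+1))) // bin_ffact.
  rewrite ffact_prod -[X in (_ ^ X)%N]card_ord -prod_nat_const.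
  by apply: leq_prod => i _; exact: leq_subr.
apply: (@le_trans _ _ (B * 2 * n%:R ^+ d.+1)).
  have S0 : 0 <= \sum_(m < N) (2^-1 : R) ^+ m.
    by apply: sumr_ge0 => m _; rewrite exprn_ge0 ?invr_ge0.
  by rewrite ler_pM ?mulr_ge0 // ler_wpM2l ?sum_half_le2.
rewrite /B le_eqVlt; apply/orP; left; apply/eqP; field.
by rewrite expf_neq0 ?gt_eqF.
Qed.

(** * Dense regime *)

(** Trivial homology leaves at most [M] simplices of dimension [d], which has
    probability at most
    [2 ^ M * (1 - p / 2) ^ N <= exp (M - N * p / 2)] with [M = 'C(n, d)] and
    [N = 'C(n, d.+1)], where [N * p / 2] exceeds [M] by a factor proportional to
    [p * n]. *)
Lemma Y_prob_trivial_le (R : realType) (n d : nat) (p : R) (F : zmodType) :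
  (0 < d)%N -> (2 * d <= n)%N -> 0 <= p <= 1 -> ~ trivial_group F ->
  4 * d.+1%:R <= p * n%:R ->
  Y_prob p d (fun D : simplicial_complex n => trivial_group (homology D F d))
    <= expR (1 - p * n%:R / (4 * d.+1%:R)).
Proof.
move=> d0 dn p01 F0 ww; have p0 : 0 <= p by case/andP: p01.
have d4 : 0 < 4 * d.+1%:R :> R by rewrite mulr_gt0.
have n0 : 0 < n%:R :> R by rewrite ltr0n; lia.
have few (D : simplicial_complex n) : in_Y d D -> trivial_group (homology D F d) ->
    (#|simplices d D| <= 'C(n, d))%N.
  move=> YD; apply: contraPT; rewrite -ltnNge => lt.
  apply: homology_neq0 (in_Y_top YD) _ => //; apply: leq_ltn_trans lt.
  rewrite -[X in 'C(X, _)]card_ord -card_draws subset_leq_card //.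
  by apply/fintype.subsetP => s; rewrite !inE prednK // => /andP[].
apply: (@le_trans _ _ (Y_prob p d (fun D : simplicial_complex n =>
    (#|simplices d D| <= 'C(n, d))%N))).
  apply: le_trans (Y_prob_union (P := @predT unit) (G := fun _ D =>
    is_true (#|simplices d D| <= 'C(n, d))%N) p01 _) _.
    by move=> D YD /(few _ YD); exists tt.
  by rewrite (big_pred1 tt) // => -[].
apply: le_trans (@Y_prob_few_le R n d p p01 'C(n, d) d0) _.
apply: (@le_trans _ _ (expR ('C(n, d)%:R * 1) * expR ('C(n, d.+1)%:R * - (p / 2)))).
  rewrite (expRM_natl 'C(n, d)) (expRM_natl 'C(n, d.+1)); have p2 : 0 <= 1 - p / 2.
    by case/andP: p01 => _; lra.
  apply: ler_pM; rewrite ?exprn_ge0 //.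
    by rewrite lerXn2r ?nnegrE ?expR_ge0 // (le_trans _ (expR_ge1Dx 1)).
  by rewrite lerXn2r ?nnegrE ?expR_ge0 // expR_ge1Dx.
rewrite -expRD ler_expR mulr1.
have b1 : 1 <= 'C(n, d)%:R :> R by rewrite ler1n bin_gt0; lia.
(* A lower bound on half the mean number of [d]-simplices, from
   [d.+1 * 'C(n, d.+1) = (n - d) * 'C(n, d)] and [n <= 2 * (n - d)]. *)
have key : 'C(n, d)%:R * (p * n%:R / (4 * d.+1%:R)) <= 'C(n, d.+1)%:R * (p / 2).
  rewrite [leLHS]mulrA ler_pdivrMr //.
  have /(congr1 (fun x => x%:R : R)) := mul_bin_left n d; rewrite !natrM => E.
  have n2 : n%:R <= 2 * (n - d)%:R :> R by rewrite -natrM ler_nat; lia.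
  have -> : 'C(n, d.+1)%:R * (p / 2) * (4 * d.+1%:R) =
     2 * p * (d.+1%:R * 'C(n, d.+1)%:R) by field.
  rewrite E [leRHS](_ : _ = 'C(n, d)%:R * (p * (2 * (n - d)%:R))); last by ring.
  by rewrite ler_wpM2l // ler_wpM2l.
have : 1 <= p * n%:R / (4 * d.+1%:R) by rewrite ler_pdivlMr // mul1r.
set y := p * n%:R / _ in key *.
by nra.
Qed.

(** * The threshold *)

Local Open Scope classical_set_scope.
Local Open Scope ring_scope.

Theorem theorem5p1 (R : realType) (d : nat) (w : nat -> R) (F : zmodType)
    (hd : (1 <= d)%N)
    (hp : forall n : nat, (0 < n)%N -> 0 <= w n / n%:R <= 1)
    (hF : ~ trivial_group F) :
  (w n @[n --> \oo] --> (0 : R) ->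
   Y_prob (w n / n%:R) d
     (fun D : simplicial_complex n => trivial_group (homology D F d))
     @[n --> \oo] --> (1 : R)) /\
  (w n @[n --> \oo] --> +oo ->
   Y_prob (w n / n%:R) d
     (fun D : simplicial_complex n => ~ trivial_group (homology D F d))
     @[n --> \oo] --> (1 : R)).
Proof.
have pn n : (0 < n)%N -> w n / n%:R * n%:R = w n.
  by move=> n0; rewrite divfK // pnatr_eq0 -lt0n.
split=> w_lim.
- pose C : R := 4 * (d`! * 4 ^ d)%:R.
  have lim1 : (fun n => 1 - C * w n) @ \oo --> (1 : R).
    rewrite -[X in _ --> X]subr0 -[X in _ --> _ - X](mulr0 C).
    by apply: cvgB; [exact: cvg_cst|apply: cvgMr].
  apply: squeeze_cvgr lim1 (cvg_cst (1 : R)).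
  have small : \forall n \near \oo, w n <= 8^-1 by apply: (cvgr_le _ w_lim).
  near=> n.
  have n0 : (0 < n)%N by near: n; exact: nbhs_infty_gt.
  rewrite Y_prob_le1 ?hp // andbT Y_prob_not ?hp // lerD2l lerN2.
  rewrite -[in leRHS](pn n n0); apply: Y_prob_nontrivial_le; rewrite ?hp // pn //.
  by near: n.
- pose b : R := 4 * d.+1%:R.
  have lim1 : (fun n => 1 - expR (1 - w n / b)) @ \oo --> (1 : R).
    rewrite -[X in _ --> X]subr0; apply: cvgB; first exact: cvg_cst.
    have -> : (fun n => expR (1 - w n / b)) = (fun x => expR (- x)) \o (fun n => w n / b - 1).
      by apply/funext => n /=; rewrite opprB.
    apply: cvg_comp (@cvgr_expR R); apply/cvgryPge => x.
    have /cvgryPge/(_ ((x + 1) * b)) := w_lim; apply: filterS => n.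
    by rewrite -ler_pdivlMr ?mulr_gt0 // lerBrDr.
  apply: squeeze_cvgr lim1 (cvg_cst (1 : R)).
  have large : \forall n \near \oo, b <= w n by move/cvgryPge : w_lim; apply.
  near=> n.
  have n0 : (0 < n)%N by near: n; exact: nbhs_infty_gt.
  have dn : (2 * d <= n)%N by near: n; exact: nbhs_infty_ge.
  rewrite Y_prob_le1 ?hp // andbT.
  rewrite [leRHS](_ : _ = 1 - Y_prob (w n / n%:R) d
    (fun D : simplicial_complex n => trivial_group (homology D F d))); last first.
    by rewrite [in RHS]Y_prob_not ?hp // opprB addrC subrK.
  rewrite lerD2l lerN2 -[in leRHS](pn n n0).
  apply: Y_prob_trivial_le; rewrite ?hp // pn //.
  by near: n.
Unshelve. all: end_near.
Qed.
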